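(* Every mass distribution $\mu$ in the plane $\mathbb{R}^2$ admits an equipartition in $6$ boxes by two parallel lines and one additional line not parallel to them; that is, there exist two parallel lines and a third line not parallel to them such that each of the $6$ boxes they determine has $\mu$-measure $\frac16\mu(\mathbb{R}^2)$.
   Context: A mass distribution in $\mathbb{R}^2$ is a finite Borel measure $\mu$ of the form $\mu(A)=\int_A f\,dx$ for an integrable density function $f:\mathbb{R}^2\to\mathbb{R}$ (integration with respect to Lebesgue measure), such that every nonempty open subset of $\mathbb{R}^2$ has positive $\mu$-measure. Boxes: two parallel lines divide the plane into $3$ consecutive regions, and a line not parallel to them divides the plane into two half-planes; the boxes are the $6$ intersections of one of the three regions with one of the two half-planes. *)

(* Defs.v *)
From HB Require Import structures.
From mathcomp Require Import all_boot all_order all_algebra.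
From mathcomp Require Import all_classical all_reals all_analysis.

Set Implicit Arguments.
Unset Strict Implicit.
Unset Printing Implicit Defensive.

Import Order.TTheory GRing.Theory Num.Theory.
Import numFieldNormedType.Exports.

Local Open Scope classical_set_scope.
Local Open Scope ring_scope.

Notation plane R := (R * R)%type.

(* [plane R] with the product of the Borel sigma-algebras (and the display of
   [lebesgue_measure \x lebesgue_measure]); this is the Borel sigma-algebra of
   the plane since R is second countable. *)
Notation borel_plane R := (measurableTypeR R * measurableTypeR R)%type.

Definition mass_distribution (R : realType)
    (mu : {finite_measure set (borel_plane R) -> \bar R}) : Prop :=
  [/\ exists f : plane R -> R,
        (lebesgue_measure \x lebesgue_measure)%E.-integrable setT (EFin \o f) /\
        forall A : set (borel_plane R), measurable A ->
          mu A = (\int[lebesgue_measure \x lebesgue_measure]_(x in A)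
                    (f x)%:E)%E
    & forall U : set (plane R), open U -> U !=set0 -> (0 < mu U)%E].

Definition dot (R : realType) (n p : plane R) : R := n.1 * p.1 + n.2 * p.2.

(* The line with normal vector [n] (to be used with [n != 0]). *)
Definition line (R : realType) (n : plane R) (c : R) : set (plane R) :=
  [set p | dot n p = c].

Definition parallel (R : realType) (L M : set (plane R)) : Prop :=
  exists t : plane R, M = [set p + t | p in L].

(* The three consecutive regions determined by the parallel lines [line n c1]
   and [line n c2], for [c1 < c2]. The regions and half-planes are taken open,
   i.e. they are the connected components of the complement of the lines; a
   mass distribution does not charge lines. *)
Definition strip (R : realType) (n : plane R) (c1 c2 : R) (i : 'I_3) :
    set (plane R) :=
  match val i with
  | 0 => [set p | dot n p < c1]
  | 1 => [set p | c1 < dot n p < c2]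
  | _ => [set p | c2 < dot n p]
  end.

Definition half_plane (R : realType) (n : plane R) (c : R) (b : bool) :
    set (plane R) :=
  if b then [set p | c < dot n p] else [set p | dot n p < c].

Definition box (R : realType) (n : plane R) (c1 c2 : R) (m : plane R) (d : R)
    (i : 'I_3) (b : bool) : set (plane R) :=
  strip n c1 c2 i `&` half_plane m d b.

(* Main.v *)
Require Import Defs.
From HB Require Import structures.
From mathcomp Require Import all_boot all_order all_algebra.
From mathcomp Require Import all_classical all_reals all_analysis.
From mathcomp Require Import measurable_realfun ring lra.

(* Fix a normal vector [n] and trisect the mass by the parallels [c1 < c2]. For
   every slope [a] relative to [n] exactly one line of slope [a] bisects the outer
   region [dot n p < c1], and exactly one bisects the other outer region; the
   difference of their heights is strictly increasing and unbounded in [a], so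
   exactly one line bisects both outer regions. By uniqueness it depends
   continuously on [n], and replacing [n] by [- n] only reverses its orientation.
   Hence the mass [halving n] below this line satisfies
   [halving n + halving (- n) = total], and along a path from [n] to [- n] it takes
   the value [total / 2]; the line then bisects the middle strip as well. *)

Import Order.TTheory GRing.Theory Num.Theory.
Import numFieldNormedType.Exports.

Local Open Scope classical_set_scope.
Local Open Scope ring_scope.

(** * Half-planes and lines: measurability, topology, Lebesgue measure *)

Section HalfPlanes.
Context {R : realType}.
Implicit Types (n m p : plane R) (c b : R).

Lemma measurable_dot n : measurable_fun setT (dot n : borel_plane R -> R).
Proof.
by apply: measurable_funD; apply: measurable_funM.
Qed.

Definition half n c : set (borel_plane R) := [set p | dot n p < c].

Lemma dotNl n p : dot (- n) p = - dot n p.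
Proof. by rewrite /dot /= !mulNr opprD. Qed.

(** Expresses upper half-planes by [half] with negated data, so that one family of sets serves both
    sides of a line. *)
Lemma half_dual n c p : half (- n) (- c) p = (c < dot n p) :> Prop.
Proof. by rewrite /half /= dotNl ltrN2. Qed.

Lemma measurable_half n c : measurable (half n c).
Proof.
have := measurable_dot n measurableT (`]-oo, c[%classic) (measurable_itv _).
by rewrite setTI; congr measurable; apply/seteqP; split => p /=; rewrite in_itv.
Qed.

Lemma measurable_line n c : measurable (line n c : set (borel_plane R)).
Proof.
have := measurable_dot n measurableT [set c] (measurable_set1 _).
by rewrite setTI.
Qed.

Lemma continuous_dot n : continuous (dot n).
Proof.
move=> p; apply: cvgD; apply: cvgM; try exact: cvg_cst.
  exact: cvg_fst.
exact: cvg_snd.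
Qed.

Lemma open_half n c : open (half n c : set (plane R)).
Proof.
apply: (@open_comp _ _ (dot n) [set x | x < c]); last exact: open_lt.
by move=> p _; exact: continuous_dot.
Qed.

Lemma open_upper_half n c : open [set p : plane R | c < dot n p].
Proof.
apply: (@open_comp _ _ (dot n) [set x | c < x]); last exact: open_gt.
by move=> p _; exact: continuous_dot.
Qed.

(** A vertical line is a product with a singleton factor; any other line has one-point vertical
    sections. *)
Lemma lebesgue_line n c : n != 0 ->
  (lebesgue_measure \x lebesgue_measure)%E (line n c) = 0%E.
Proof.
case: n => n1 n2; have [-> /= n0|n20 _] := eqVneq n2 0.
  have {}n0 : n1 != 0 by apply: contra_neq n0 => ->.
  have -> : line (n1, 0) c = [set c / n1] `*` setT.
    apply/seteqP; split=> -[x y]; rewrite /line /dot /= mul0r addr0.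
      by move=> <-; split=> //; rewrite mulrC mulKf.
    by move=> [-> _]; rewrite mulrC divfK.
  rewrite product_measure1E// [X in (X * _)%E](_ : _ = 0%E) ?mul0e//.
  exact: lebesgue_measure_set1.
rewrite /product_measure1 integral0_eq// => x _ /=.
have -> : xsection (line (n1, n2) c) x = [set (c - n1 * x) / n2].
  apply/seteqP; split=> y; rewrite /xsection /line /dot /= inE /=.
    by move=> <-; rewrite addrC addKr mulrC mulKf.
  by move=> ->; rewrite [n2 * _]mulrC divfK// addrC subrK.
exact: lebesgue_measure_set1.
Qed.

End HalfPlanes.

(** * Continuity of moving measures, implicit functions, intermediate values *)

(** Dominated convergence along sequences: the indicators stabilise pointwise off the null set [N]
    and are bounded by the constant 1, integrable for a finite measure. *)
Lemma measure_family_continuous_at {R : realType} d (T : measurableType d)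
    (mu : {finite_measure set T -> \bar R}) (A : R -> set T) (N : set T) t0 :
  (forall t, measurable (A t)) -> measurable N -> mu N = 0%E ->
  (forall p, ~ N p -> \forall t \near t0, A t p <-> A t0 p) ->
  {for t0, continuous (fun t => fine (mu (A t)))}.
Proof.
move=> mA mN muN0 At0; apply/(@cvg_nbhsP _ R^o) => u ut0.
apply: fine_cvg; rewrite fineK ?fin_num_measure//.
have muE B : measurable B -> mu B = (\int[mu]_x (\1_B x)%:E)%E.
  by move=> mB; rewrite integral_indic// setIT.
rewrite (muE (A t0))//.
under eq_fun do rewrite muE//.
have mI B : measurable B -> measurable_fun setT (EFin \o \1_B : T -> \bar R).
  by move=> mB; apply: measurableT_comp => //; exact: measurable_indic.
have cvgI : {ae mu, forall p, setT p ->
    (fun n => (\1_(A (u n)) p)%:E : \bar R) @ \oo --> (\1_(A t0) p)%:E}.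
  exists N; split=> // p /= /not_implyP[_ nAp]; apply: contrapT => Np.
  apply: nAp; apply: cvg_near_cst.
  have Aut0 : \forall n \near \oo, A (u n) p <-> A t0 p := ut0 _ (At0 _ Np).
  near=> n; have Aun : A (u n) p <-> A t0 p by near: n; exact: Aut0.
  rewrite !indicE; congr ((nat_of_bool _)%:R%:E).
  by apply/idP/idP; rewrite !inE => /Aun.
have int1 := finite_measure_integrable_cst mu 1 (@measurableT _ T).
have leI p n : setT p -> (`|(\1_(A (u n)) p)%:E| <= 1%:E :> \bar R)%E.
  by rewrite lee_fin indicE; case: (p \in _); rewrite ?normr1 ?normr0.
by have [] := dominated_convergence measurableT (fun n => mI _ (mA (u n)))
  (mI _ (mA t0)) cvgI int1 (aeW mu leI).
Unshelve. all: by end_near. Qed.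

(** At [z t0 - e] and [z t0 + e] the values of [F t0] lie strictly on either side of [v]; this
    persists for [t] near [t0], and monotonicity traps [z t] in between. *)
Lemma implicit_continuous {R : realType} (F : R -> R -> R) (z : R -> R) v t0 :
  (forall t x y, x < y -> F t x < F t y) ->
  (forall y, {for t0, continuous (F ^~ y)}) ->
  (forall t, F t (z t) = v) -> {for t0, continuous z}.
Proof.
move=> Fmono Fcont Fz; apply/cvgrPdist_lt => e e0.
have lo : F t0 (z t0 - e) < v by rewrite -(Fz t0) Fmono// ltrBlDr ltrDl.
have hi : v < F t0 (z t0 + e) by rewrite -(Fz t0) Fmono// ltrDl.
have Fle t x y : F t x < F t y -> x < y.
  by apply: contraTT; rewrite -!leNgt le_eqVlt => /predU1P[->//|/Fmono/ltW].
near=> t; rewrite ltr_distlC; apply/andP; split; apply: (Fle t); rewrite Fz.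
  by near: t; exact: cvgr_lt (Fcont _) _ lo.
by near: t; exact: cvgr_gt (Fcont _) _ hi.
Unshelve. all: by end_near. Qed.

Lemma IVT_exists {R : realType} (f : R -> R) x y v :
  continuous f -> f x <= v -> v <= f y -> exists c, f c = v.
Proof.
move=> fc fx fy.
have within a b : {within `[a, b], continuous f}.
  exact: continuous_subspaceT.
have [xy|/ltW yx] := leP x y.
- have [|c _ <-] := @IVT R f x y v xy (within _ _); last by exists c.
  by rewrite ge_min fx le_max fy orbT.
- have [|c _ <-] := @IVT R f y x v yx (within _ _); last by exists c.
  by rewrite ge_min fx le_max fy orbT.
Qed.

Definition det {R : realType} (n m : plane R) : R := n.1 * m.2 - n.2 * m.1.

(** * Masses of half-planes and wedges *)

Section Mass.
Context {R : realType} (mu : {finite_measure set (borel_plane R) -> \bar R}).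
Implicit Types (A B : set (borel_plane R)) (n m p : plane R) (c b v : R).

Definition mass A : R := fine (mu A).

Lemma massE A : measurable A -> (mass A)%:E = mu A.
Proof. by move=> mA; rewrite fineK// fin_num_measure. Qed.

Lemma mass_ge0 A : 0 <= mass A.
Proof. exact: fine_ge0. Qed.

Lemma le_mass A B : measurable A -> measurable B -> A `<=` B ->
  mass A <= mass B.
Proof. by move=> mA mB AB; rewrite -lee_fin !massE// le_measure ?inE. Qed.

Lemma massU A B : measurable A -> measurable B -> A `&` B = set0 ->
  mass (A `|` B) = mass A + mass B.
Proof.
move=> mA mB AB; apply: EFin_inj; rewrite EFinD !massE ?measureU//.
exact: measurableU.
Qed.

Definition wedge n c m b : R := mass (half n c `&` half m b).

Lemma measurable_wedge n c m b : measurable (half n c `&` half m b).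
Proof. by apply: measurableI; exact: measurable_half. Qed.

(* The disjunct [n = 0 /\ 0 < c] makes [half n c] the whole plane, so that
   single half-planes are covered by the results on wedges. *)
Definition transversal n c m : Prop :=
  m != 0 /\ (n = 0 /\ 0 < c \/ det n m != 0).

Lemma plane_neq0 n : (n != 0) = (n.1 ^+ 2 + n.2 ^+ 2 != 0).
Proof.
case: n => x y /=; rewrite paddr_eq0 ?sqr_ge0// !sqrf_eq0; congr negb.
Qed.

Lemma transversal_point n c m b : transversal n c m ->
  exists p, dot n p < c /\ dot m p = b.
Proof.
move=> [m0 [[-> c0]|d0]].
  rewrite plane_neq0 in m0.
  exists (b / (m.1 ^+ 2 + m.2 ^+ 2) * m.1, b / (m.1 ^+ 2 + m.2 ^+ 2) * m.2).
  by rewrite /dot /= !mul0r addr0; split => //; field.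
(* Cramer's rule for [dot n p = c - 1] and [dot m p = b]; any value below [c] would do. *)
exists (((c - 1) * m.2 - b * n.2) / det n m,
  (n.1 * b - (c - 1) * m.1) / det n m).
rewrite /det in d0 *; split; last by rewrite /dot /=; field.
rewrite [ltLHS](_ : _ = c - 1) ?ltrBlDr ?ltrDl//.
by rewrite /dot /=; field.
Qed.

Context (mu_open : forall U : set (plane R),
  open U -> U !=set0 -> (0 < mu U)%E).

(** The larger wedge also contains the open piece [U] between the two lines, nonempty by
    transversality and so of positive mass. *)
Lemma wedge_lt n c m b b' : transversal n c m -> b < b' ->
  wedge n c m b < wedge n c m b'.
Proof.
move=> tr bb'.
pose U : set (plane R) :=
  half n c `&` [set p | b < dot m p] `&` half m b'.
have [p [pc pm]] := transversal_point _ _ _ ((b + b') / 2) tr.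
have mU : measurable (U : set (borel_plane R)).
  rewrite /U; apply: measurableI; last exact: measurable_half.
  apply: measurableI; first exact: measurable_half.
  rewrite (_ : [set p | _] = ~` (half m b `|` line m b)).
    apply: measurableC; apply: measurableU; first exact: measurable_half.
    exact: measurable_line.
  apply/seteqP; split=> x; rewrite /half /line /=.
    by move=> bx [|xb];
      [move/(lt_trans bx)|move: bx; rewrite xb]; rewrite ltxx.
  move=> /not_orP[/negP + /eqP]; rewrite -leNgt le_eqVlt eq_sym.
  by move=> /predU1P[->|//]; rewrite eqxx.
have U0 : 0 < mass U.
  rewrite -lte_fin massE//; apply: mu_open.
    apply: openI; last exact: open_half.
    by apply: openI; [exact: open_half|exact: open_upper_half].
  by exists p; split; rewrite /half/=; [split => //=|]; rewrite pm; lra.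
apply: (@lt_le_trans _ _ (wedge n c m b + mass U)); first by rewrite ltrDl.
rewrite /wedge -massU//; [|exact: measurable_wedge|].
  apply: le_mass; [|exact: measurable_wedge|].
    by apply: measurableU => //; exact: measurable_wedge.
  by move=> x [[nx mx]|[[nx _] mx]]; split => //; exact: lt_trans bb'.
rewrite -subset0 => x [[_ mx] [[_ /= bx] _]].
by have := lt_trans mx bx; rewrite ltxx.
Qed.

Context (mu_line : forall n c, n != 0 -> mu (line n c) = 0%E).


(** The boundary line is null, so the two open sides carry all the mass. *)
Lemma mass_split A m b : m != 0 -> measurable A ->
  mass A = mass (A `&` half m b) + mass (A `&` half (- m) (- b)).
Proof.
move=> m0 mA.
have [mh mh' ml] : [/\ measurable (half m b), measurable (half (- m) (- b))
    & measurable (line m b : set (borel_plane R))].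
  by split; [exact: measurable_half..|exact: measurable_line].
have massl : mass (A `&` line m b) = 0.
  apply/eqP; rewrite eq_le mass_ge0 andbT.
  apply: (@le_trans _ _ (mass (line m b))); last by rewrite /mass mu_line.
  by apply: le_mass => //; exact: measurableI.
have mAh : measurable (A `&` half m b) by exact: measurableI.
have mAh' : measurable (A `&` half (- m) (- b)) by exact: measurableI.
have mAl : measurable (A `&` line m b) by exact: measurableI.
rewrite -massU//; last first.
  rewrite -subset0 => x [[_ +] [_]]; rewrite /half /= dotNl ltrN2 => /lt_trans H.
  by move=> /H; rewrite ltxx.
rewrite -[RHS]addr0 -massl -massU//; first last.
- rewrite -subset0 => x [+ [_]]; rewrite /half /line => + /= xb.
  by move=> [] [_ /=]; rewrite ?dotNl xb ltxx.
- exact: measurableU.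
congr mass; apply/seteqP; split=> [x Ax|x [[][]//|[]//]].
rewrite /half /line /= dotNl ltrN2; have [xb|xb|xb] := ltgtP (dot m x) b.
- by left; left.
- by left; right.
- by right.
Qed.

(** A point off both boundary lines at [t0] keeps its sides for nearby [t], and these lines form a
    null set. *)
Lemma wedge_continuous_at (n m : R -> plane R) (c b : R -> R) t0 :
  {for t0, continuous n} -> {for t0, continuous c} ->
  {for t0, continuous m} -> {for t0, continuous b} ->
  transversal (n t0) (c t0) (m t0) ->
  {for t0, continuous (fun t => wedge (n t) (c t) (m t) (b t))}.
Proof.
move=> nc cc mc bc [m0 nm].
pose N : set (borel_plane R) := line (n t0) (c t0) `|` line (m t0) (b t0).
have mN : measurable N by apply: measurableU; exact: measurable_line.
have nl : mu (line (n t0) (c t0)) = 0%E.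
  (* [mu_line] needs a nonzero normal; for [n t0 = 0] the line is empty because [0 < c t0]. *)
  have [n0|/mu_line//] := eqVneq (n t0) 0; rewrite n0 in nm *.
  case: nm => [[_ c0]|]; last by rewrite /det /= !mul0r subrr eqxx.
  rewrite (_ : line _ _ = set0) ?measure0// -subset0 => p.
  by rewrite /line /dot /= !mul0r addr0 => c0'; rewrite -c0' ltxx in c0.
have muN : mu N = 0%E.
  by rewrite /N null_set_setU//; [exact: measurable_line..|exact: mu_line].
apply: (measure_family_continuous_at _ _ mu _ N) => //.
  by move=> t; exact: measurable_wedge.
have near_half (k : R -> plane R) (e : R -> R) p : {for t0, continuous k} ->
    {for t0, continuous e} -> dot (k t0) p <> e t0 ->
    \forall t \near t0, half (k t) (e t) p <-> half (k t0) (e t0) p.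
  move=> kc ec /eqP ke.
  have dc : (fun t => e t - dot (k t) p) @ t0 --> e t0 - dot (k t0) p.
    apply: cvgB => //; apply: cvgD; apply: cvgM; try exact: cvg_cst.
      by apply: (cvg_comp _ _ kc); exact: cvg_fst.
    by apply: (cvg_comp _ _ kc); exact: cvg_snd.
  move: ke; rewrite neq_lt => /orP[ke|ke].
    have : \forall t \near t0, 0 < e t - dot (k t) p.
      by apply: (cvgr_gt _ dc); rewrite subr_gt0.
    by apply: filterS => t; rewrite subr_gt0 /half /=.
  have : \forall t \near t0, e t - dot (k t) p < 0.
    by apply: (cvgr_lt _ dc); rewrite subr_lt0.
  apply: filterS => t; rewrite subr_lt0 /half /= => /ltW; rewrite leNgt.
  by move=> /negbTE ->; rewrite ltNge (ltW ke).
move=> p /not_orP[np mp].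
have := near_half _ _ _ mc bc mp; have := near_half _ _ _ nc cc np.
by apply: filterS2 => t h1 h2; split=> -[? ?]; split; (apply/h1 || apply/h2).
Qed.

(** Continuity from below: the wedges at integer heights exhaust the half-plane. *)
Lemma wedge_gt n c m v : v < mass (half n c) -> exists b, v < wedge n c m b.
Proof.
move=> vn; pose F (k : nat) := half n c `&` half m k%:R.
have UF : \bigcup_k F k = half n c.
  apply/seteqP; split=> [p [k _ []]//|p np].
  exists (Num.truncn `|dot m p|).+1 => //; split => //; rewrite /half /=.
  by apply: le_lt_trans (truncnS_gt _); exact: ler_norm.
have mF k : measurable (F k) by exact: measurable_wedge.
have ndF : nondecreasing_seq F.
  move=> i j ij; apply/subsetPset => p [np mp]; split => //.
  by apply: lt_le_trans mp _; rewrite ler_nat.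
have mUF : measurable (\bigcup_k F k) by rewrite UF; exact: measurable_half.
have cvgF : mass (F k) @[k --> \oo] --> mass (half n c).
  apply: fine_cvg; rewrite massE; last exact: measurable_half.
  by rewrite -UF; exact: nondecreasing_cvg_mu.
have [k _ Hk] := cvgr_gt _ cvgF _ vn.
by exists k%:R; exact: Hk (leqnn k).
Qed.

Lemma wedge_surj n c m v : transversal n c m -> 0 < v < mass (half n c) ->
  exists b, wedge n c m b = v.
Proof.
move=> tr /andP[v0 vn].
have [b2 vb2] := wedge_gt _ _ m _ vn.
(* Applied to [- m], [wedge_gt] makes the complementary wedge heavy, hence the wedge at [- b1]
   lighter than [v]. *)
have [|b1 vb1] := wedge_gt n c (- m) (mass (half n c) - v).
  by rewrite ltrBlDr ltrDl.
have wb1 : wedge n c m (- b1) < v.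
  move: vb1; rewrite (mass_split (half n c) m (- b1)) ?opprK; last 2 first.
  - by case: tr.
  - exact: measurable_half.
  by rewrite -/(wedge n c m (- b1)) -/(wedge n c (- m) b1); lra.
apply: (IVT_exists _ _ _ _ _ (ltW wb1) (ltW vb2)) => b.
by apply: (wedge_continuous_at (cst n) (cst m) (cst c) id) => //; exact: cvg_cst.
Qed.

(** Serves for [third] and [height], both solutions of wedge equations; strict monotonicity comes
    from [wedge_lt]. *)
Lemma wedge_solution_continuous (n m : R -> plane R) (c z : R -> R) v :
  continuous n -> continuous m -> continuous c ->
  (forall t, transversal (n t) (c t) (m t)) ->
  (forall t, wedge (n t) (c t) (m t) (z t) = v) -> continuous z.
Proof.
move=> nc mc cc tr zv t.
apply: (implicit_continuous (fun t => wedge (n t) (c t) (m t)) z v t) => //.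
  by move=> s x y; exact: wedge_lt.
move=> y; apply: (wedge_continuous_at n m c (cst y)); try exact: cvg_cst.
all: by [exact: nc|exact: cc|exact: mc|].
Qed.

Lemma wedge_full n b : wedge 0 1 n b = mass (half n b).
Proof.
rewrite /wedge (_ : half 0 1 = setT) ?setTI// -subTset => p _.
by rewrite /half /dot /= !mul0r addr0.
Qed.

Lemma transversal_full n : n != 0 -> transversal 0 1 n.
Proof. by move=> n0; split=> //; left. Qed.

(** * Trisecting parallels and bisectors of an outer region *)

Definition total : R := mass setT.

Lemma total_gt0 : 0 < total.
Proof.
rewrite -lte_fin massE//; apply: mu_open; first exact: openT.
by exists 0.
Qed.

(** The default 0 of [xget] matters only when no solution exists, which [mass_third] excludes for
    [n != 0]. *)
Definition third n : R := xget 0 [set c | mass (half n c) = total / 3].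

Lemma mass_third n : n != 0 -> mass (half n (third n)) = total / 3.
Proof.
move=> n0; apply: (@xgetPex _ 0 [set c | mass (half n c) = total / 3]).
have [|c] := wedge_surj 0 1 n (total / 3) (transversal_full _ n0).
  rewrite (_ : half 0 1 = setT) -/total; first by have := total_gt0; lra.
  by rewrite -subTset => p _; rewrite /half /dot /= !mul0r addr0.
by rewrite wedge_full => nc; exists c.
Qed.

(* The line [dot (tilt n a) p = b] is [t = a * s + b] in the coordinates
   [s = n.1 * p.1 + n.2 * p.2] and [t = n.1 * p.2 - n.2 * p.1]. *)
Definition tilt n a : plane R := (- n.2 - a * n.1, n.1 - a * n.2).

(** The determinant is the squared norm of [n], whatever the slope. *)
Lemma det_tilt n a : n != 0 -> det n (tilt n a) != 0.
Proof.
rewrite plane_neq0 /det /tilt /= => n0; apply: contra_neq n0 => <-.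
by rewrite !expr2; ring.
Qed.

Lemma det_neq0 n m : det n m != 0 -> m != 0.
Proof. by apply: contra_neq => ->; rewrite /det /= !mulr0 subrr. Qed.

Lemma transversal_tilt n c a : n != 0 -> transversal n c (tilt n a).
Proof.
move=> n0; have d0 := det_tilt n a n0.
by split; [exact: det_neq0 d0|right].
Qed.

Lemma tiltN n a : tilt (- n) a = - tilt n a.
Proof. by rewrite /tilt /=; congr pair; rewrite /=; ring. Qed.

Definition height n a : R :=
  xget 0 [set b | wedge n (third n) (tilt n a) b = total / 6].

Lemma wedge_height n a : n != 0 ->
  wedge n (third n) (tilt n a) (height n a) = total / 6.
Proof.
move=> n0.
apply: (@xgetPex _ 0 [set b | wedge n (third n) (tilt n a) b = total / 6]).
apply: wedge_surj; first exact: transversal_tilt.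
by rewrite mass_third//; have := total_gt0; lra.
Qed.

(* Otherwise, over the half-plane [half n (third n)], the line of slope [a'] would
   lie strictly below the line of slope [a], although both bisect its mass. *)
Lemma height_slope n a a' : n != 0 -> a <= a' ->
  height n a - (a' - a) * third n <= height n a'.
Proof.
move=> n0 aa'; rewrite leNgt; apply/negP => h.
have tr := transversal_tilt n (third n) a n0.
(* At this height the line of slope [a] meets the bisector of slope [a'] on [dot n p = third n]. *)
have := wedge_lt _ _ _ (height n a' + (a' - a) * third n) (height n a) tr.
rewrite wedge_height// => /(_ ltac:(by rewrite -ltrBrDr)).
rewrite -(wedge_height n a')// ltNge => /negP; apply.
apply: le_mass; [exact: measurable_wedge|exact: measurable_wedge|].
move=> p []; rewrite /half /dot /tilt /= => np mp; split => //=.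
have : (a' - a) * (n.1 * p.1 + n.2 * p.2) <= (a' - a) * third n.
  by apply: ler_wpM2l; [rewrite subr_ge0|exact: ltW].
by move: mp; lra.
Qed.

(** Otherwise the two outer thirds would cover the plane up to a null line, leaving at most two
    thirds of the mass in all. *)
Lemma third_gap n : n != 0 -> third n < - third (- n).
Proof.
move=> n0; rewrite ltNge; apply/negP => le_third.
have : mass (half n (- third (- n))) <= mass (half n (third n)).
  apply: le_mass; [exact: measurable_half|exact: measurable_half|].
  by move=> p; rewrite /half /= => /lt_le_trans; exact.
have := mass_split setT n (- third (- n)) n0 measurableT.
rewrite !setTI opprK !mass_third ?oppr_eq0// -/total.
by have := total_gt0; lra.
Qed.

Lemma third_continuous (n : R -> plane R) : continuous n ->
  (forall t, n t != 0) -> continuous (third \o n).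
Proof.
move=> nc n0; apply: (@wedge_solution_continuous (cst 0) n (cst 1) _ (total / 3)).
- by move=> t; exact: cvg_cst.
- exact: nc.
- by move=> t; exact: cvg_cst.
- by move=> t; exact: transversal_full.
- by move=> t; rewrite wedge_full mass_third.
Qed.

Lemma tilt_continuous (n : R -> plane R) (a : R -> R) : continuous n ->
  continuous a -> continuous (fun t => tilt (n t) (a t)).
Proof.
move=> nc ac t; have n1 : (n x).1 @[x --> t] --> (n t).1.
  by apply: (cvg_comp _ _ (nc t)); exact: cvg_fst.
have n2 : (n x).2 @[x --> t] --> (n t).2.
  by apply: (cvg_comp _ _ (nc t)); exact: cvg_snd.
have c1 : - (n x).2 - a x * (n x).1 @[x --> t] --> - (n t).2 - a t * (n t).1.
  by apply: cvgB; [exact: cvgN|apply: cvgM => //; exact: ac].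
have c2 : (n x).1 - a x * (n x).2 @[x --> t] --> (n t).1 - a t * (n t).2.
  by apply: cvgB => //; apply: cvgM => //; exact: ac.
exact: (cvg_pair c1 c2).
Qed.

Lemma height_continuous (n : R -> plane R) (a : R -> R) : continuous n ->
  (forall t, n t != 0) -> continuous a ->
  continuous (fun t => height (n t) (a t)).
Proof.
move=> nc n0 ac.
apply: (wedge_solution_continuous n (fun t => tilt (n t) (a t)) (third \o n) _
  (total / 6)) => //.
- exact: tilt_continuous.
- exact: third_continuous.
- by move=> t; exact: transversal_tilt.
- by move=> t; exact: wedge_height.
Qed.

(* The mass-bisecting line of slope [a] of the opposite half-plane
   [half (- n) (third (- n))] has height [- height (- n) a], because
   [tilt (- n) a = - tilt n a]; it is the same line when [offset n a = 0]. *)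
Definition offset n a : R := height n a + height (- n) a.

(** Adding [height_slope] for [n] and [- n] yields as growth rate the gap between the trisecting
    levels. *)
Lemma offset_slope n a a' : n != 0 -> a <= a' ->
  offset n a + (a' - a) * (- third (- n) - third n) <= offset n a'.
Proof.
move=> n0 aa'; have := height_slope n a a' n0 aa'.
by have := height_slope (- n) a a'; rewrite oppr_eq0 /offset => /(_ n0 aa'); lra.
Qed.

Lemma offset_lt n a a' : n != 0 -> a < a' -> offset n a < offset n a'.
Proof.
move=> n0 aa'; apply: lt_le_trans (offset_slope n a a' n0 (ltW aa')).
by rewrite ltrDl mulr_gt0// subr_gt0//; exact: third_gap.
Qed.

(** * The line bisecting both outer regions *)

Definition slope n : R := xget 0 [set a | offset n a = 0].

Lemma offset_slope0 n : n != 0 -> offset n (slope n) = 0.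
Proof.
move=> n0; apply: (@xgetPex _ 0 [set a | offset n a = 0]).
pose g := - third (- n) - third n.
have g0 : 0 < g by rewrite subr_gt0; exact: third_gap.
(* Growth at rate at least [g] over a length [K] makes up for [offset n 0], so a zero lies between
   [- K] and [K]. *)
pose K := `|offset n 0| / g.
have K0 : 0 <= K by rewrite divr_ge0// ltW.
have Kg : K * g = `|offset n 0| by rewrite divfK// gt_eqF.
have offc : continuous (offset n).
  have cN m : m != 0 -> continuous (height m).
    move=> m0; apply: (height_continuous (cst m) id) => // t;
      [exact: cvg_cst|exact: cvg_id].
  by move=> a; apply: cvgD; apply: cN; rewrite ?oppr_eq0.
apply: (IVT_exists _ (- K) K _ offc).
  have := offset_slope n (- K) 0 n0; rewrite oppr_le0 => /(_ K0).
  by rewrite sub0r opprK -/g Kg; have := ler_norm (offset n 0); lra.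
have := offset_slope n 0 K n0 K0; rewrite subr0 -/g Kg.
by have := ler_norm (- offset n 0); rewrite normrN; lra.
Qed.

(** [offset] is unchanged when [n] becomes [- n], so [xget] chooses from the same set. *)
Lemma slopeN n : slope (- n) = slope n.
Proof.
by rewrite /slope; congr xget; apply/funext => a; rewrite /= /offset opprK addrC.
Qed.

Lemma slope_continuous (n : R -> plane R) : continuous n ->
  (forall t, n t != 0) -> continuous (slope \o n).
Proof.
move=> nc n0 t; apply: (implicit_continuous (fun t => offset (n t)) _ 0).
- by move=> s a a'; exact: offset_lt.
- move=> a; have ca : continuous (cst a : R -> R) by move=> x; exact: cvg_cst.
  apply: cvgD; first exact: (height_continuous n (cst a)).
  apply: (height_continuous (fun t => - n t) (cst a)) => //.
    by move=> x; apply: cvgN; exact: nc.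
  by move=> x; rewrite oppr_eq0.
- by move=> s; exact: offset_slope0.
Qed.

(** * Halving the total mass by turning the normal *)

Definition halving n : R := mass (half (tilt n (slope n)) (height n (slope n))).

(** As [offset n (slope n) = 0], the data of [- n] describe the line of [n] with its sides
    exchanged. *)
Lemma halvingN n : n != 0 -> halving n + halving (- n) = total.
Proof.
move=> n0; rewrite /halving slopeN tiltN.
have /eqP := offset_slope0 n n0; rewrite addr_eq0 => /eqP ->.
have m0 := det_neq0 _ _ (det_tilt n (slope n) n0).
by rewrite /total (mass_split setT _ (- height (- n) (slope n)) m0)//
  !setTI opprK.
Qed.

Lemma halving_continuous (n : R -> plane R) : continuous n ->
  (forall t, n t != 0) -> continuous (halving \o n).
Proof.
move=> nc n0 t; have sc := slope_continuous n nc n0.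
pose m t := tilt (n t) ((slope \o n) t).
pose b t := height (n t) ((slope \o n) t).
have -> : halving \o n = fun t => wedge 0 1 (m t) (b t).
  by apply/funext => s; rewrite wedge_full.
apply: (wedge_continuous_at (cst 0) m (cst 1) b); try exact: cvg_cst.
- exact: tilt_continuous.
- exact: height_continuous.
- by apply: transversal_full; apply: det_neq0; exact: det_tilt.
Qed.

Lemma halving_eq : exists n, n != 0 /\ halving n = total / 2.
Proof.
(* On [[-1, 1]] this is a parabolic arc from [(-1, 0)] through [(0, 1)] to [(1, 0)]: a polynomial
   path between opposite normals that avoids the origin. *)
pose n (t : R) : plane R := (t, 1 - t * t).
have nc : continuous n.
  move=> t; have c2 : 1 - x * x @[x --> t] --> 1 - t * t.
    by apply: cvgB; [exact: cvg_cst|apply: cvgM; exact: cvg_id].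
  exact: (cvg_pair cvg_id c2).
have n0 t : n t != 0.
  apply/eqP => -[-> /eqP]; rewrite mulr0 subr0; exact/negP/oner_neq0.
have hc := halving_continuous n nc n0.
have hN : halving (n 1) + halving (n (- 1)) = total.
  have -> : n (- 1) = - n 1.
    by rewrite /n mulrNN mulr1 subrr; congr pair; rewrite oppr0.
  exact: halvingN.
have [t ht] : exists t, (halving \o n) t = total / 2.
  (* The values at [1] and [-1] add up to [total], so [total / 2] lies between them, in one order or
     the other. *)
  have [h|h] := leP (halving (n 1)) (total / 2).
    by apply: (IVT_exists _ 1 (- 1) _ hc); rewrite /=; lra.
  by apply: (IVT_exists _ (- 1) 1 _ hc); rewrite /=; lra.
by exists (n t).
Qed.

Lemma mass_strip A n c c' : measurable A -> n != 0 -> c < c' ->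
  mass A = mass (A `&` half n c)
    + mass (A `&` (half (- n) (- c) `&` half n c'))
    + mass (A `&` half (- n) (- c')).
Proof.
move=> mA n0 cc'; have mh m b : measurable (half m b) := measurable_half m b.
have mAh : measurable (A `&` half (- n) (- c)) by exact: measurableI.
rewrite [LHS](mass_split A n c)// -addrA; congr (_ + _).
rewrite [LHS](mass_split _ n c')// -!setIA; congr (_ + mass (_ `&` _)).
(* Beyond [c'] the bound by [c] is automatic, as [c < c']. *)
apply/seteqP; split=> [p []//|p]; rewrite /setI /= !half_dual => h.
by split=> //; exact: lt_trans h.
Qed.

End Mass.

(** * Parallelism of lines, and the equipartition *)

(** Translate by the multiple of [n] that raises [dot n] by [c' - c]. *)
Lemma parallel_line {R : realType} (n : plane R) c c' : n != 0 ->
  parallel (line n c) (line n c').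
Proof.
rewrite plane_neq0 => n0; pose k := (c' - c) / (n.1 ^+ 2 + n.2 ^+ 2).
have kn : k * (n.1 ^+ 2 + n.2 ^+ 2) = c' - c by rewrite divfK.
exists (k * n.1, k * n.2); apply/seteqP; split => [p|_ [p + <-]];
  rewrite /line /dot /=.
  move=> pc; exists (p - (k * n.1, k * n.2)); last by rewrite subrK.
  by rewrite /=; lra.
by lra.
Qed.

(** Two points of the first line differing by [(- n.2, n.1)] would both translate into the second,
    but [dot m] of this difference is [det n m]. *)
Lemma not_parallel_line {R : realType} (n m : plane R) c d : det n m != 0 ->
  ~ parallel (line n c) (line m d).
Proof.
move=> d0 [t md].
have n0 : n.1 ^+ 2 + n.2 ^+ 2 != 0.
  rewrite -plane_neq0; apply: contra_neq d0 => ->.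
  by rewrite /det /= !mul0r subrr.
pose k := c / (n.1 ^+ 2 + n.2 ^+ 2).
have kc : k * (n.1 ^+ 2 + n.2 ^+ 2) = c by rewrite divfK.
have in_md p : line n c p -> line m d (p + t) by move=> np; rewrite md; exists p.
have h0 : line m d ((k * n.1, k * n.2) + t).
  by apply: in_md; rewrite /line /dot /=; lra.
have h1 : line m d ((k * n.1 - n.2, k * n.2 + n.1) + t).
  by apply: in_md; rewrite /line /dot /=; lra.
move/eqP: d0; apply; move: h0 h1; rewrite /line /dot /det /=; lra.
Qed.

Lemma mass_distribution_line {R : realType}
    (mu : {finite_measure set (borel_plane R) -> \bar R}) (n : plane R) (c : R) :
  mass_distribution mu -> n != 0 -> mu (line n c) = 0%E.
Proof.
move=> [[f [intf muf]] _] n0.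
have ml : measurable (line n c : set (borel_plane R)) := measurable_line n c.
rewrite muf// null_set_integral//; last exact: lebesgue_line.
exact: measurable_funS (measurable_int _ intf).
Qed.

Theorem claim1 (R : realType) (mu : {finite_measure set (borel_plane R) -> \bar R})
    (hmu : mass_distribution mu) :
  exists (n : plane R) (c1 c2 : R) (m : plane R) (d : R),
    [/\ n != 0, m != 0, c1 < c2,
        parallel (line n c1) (line n c2) /\ ~ parallel (line n c1) (line m d)
      & forall (i : 'I_3) (b : bool),
          mu (box n c1 c2 m d i b) = ((6%:R^-1)%:E * mu setT)%E].
Proof.
have mu_line n c := mass_distribution_line mu n c hmu.
have [_ mu_open] := hmu.
have [n [n0 halvn]] := halving_eq mu mu_open mu_line.
set M := total mu in halvn; pose a := slope mu n; pose m := tilt n a.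
(* The sign in [c2] turns the lower third for [- n] into the upper third for [n]. *)
pose d := height mu n a; pose c1 := third mu n; pose c2 := - third mu (- n).
have d0 : det n m != 0 := det_tilt n a n0.
have m0 : m != 0 := det_neq0 _ _ d0.
have nN0 : - n != 0 by rewrite oppr_eq0.
have c12 : c1 < c2 := third_gap mu mu_open mu_line n n0.
have left_third : mass mu (half n c1) = M / 3 := mass_third mu mu_open mu_line n n0.
have right_third : mass mu (half (- n) (- c2)) = M / 3.
  by rewrite opprK; exact: mass_third.
have left_low : mass mu (half n c1 `&` half m d) = M / 6.
  exact: wedge_height.
have right_up : mass mu (half (- n) (- c2) `&` half (- m) (- d)) = M / 6.
  (* Since the offset vanishes, the bisector of the opposite outer region is the same line with
     reversed normal. *)
  rewrite opprK -tiltN (_ : - d = height mu (- n) a); first exact: wedge_height.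
  have := offset_slope0 mu mu_open mu_line n n0.
  by rewrite /offset -/a -/d => /eqP; rewrite addr_eq0 => /eqP ->; rewrite opprK.
have mh k e : measurable (half k e : set (borel_plane R)) := measurable_half k e.
have low : mass mu (half m d) = M / 2 by [].
have up : mass mu (half (- m) (- d)) = M / 2.
  have := mass_split mu mu_line setT m d m0 measurableT.
  by rewrite !setTI -/(total mu) -/M; lra.
have left_split := mass_split mu mu_line (half n c1) m d m0 (mh _ _).
have right_split := mass_split mu mu_line (half (- n) (- c2)) m d m0 (mh _ _).
have low_split := mass_strip mu mu_line _ n c1 c2 (mh m d) n0 c12.
have up_split := mass_strip mu mu_line _ n c1 c2 (mh (- m) (- d)) n0 c12.
exists n, c1, c2, m, d; split => //.
  by split; [exact: parallel_line|exact: not_parallel_line].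
have halfE b : half_plane m d b = if b then half (- m) (- d) else half m d.
  by case: b => //; apply/seteqP; split=> p; rewrite half_dual.
have stripE i : strip n c1 c2 i = if val i == 0%N then half n c1 else
    if val i == 1%N then half (- n) (- c1) `&` half n c2 else half (- n) (- c2).
  case: i => -[|[|[|//]]] i3 /=; rewrite /strip /=.
  - by [].
  - apply/seteqP; split=> p; rewrite /setI /= !half_dual; first by move/andP.
    by move=> [? ?]; apply/andP.
  - by apply/seteqP; split=> p; rewrite half_dual.
move=> i b; rewrite /box halfE stripE -[mu setT]massE// -/(total mu) -/M -EFinM.
rewrite -massE; last first.
  apply: measurableI; last by case: b.
  by case: ifP => _ //; case: ifP => _ //; exact: measurableI.
(* The outer boxes are known or follow from [left_split] and [right_split]; each middle box is then
   [M / 2 - M / 6 - M / 6]. *)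
congr EFin; move: low_split up_split.
rewrite !(setIC (half m d)) !(setIC (half (- m) (- d))).
by case: i => -[|[|[|//]]] i3 /=; case: b; lra.
Qed.
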